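(* Let $a,c\in\mathbb{C}$ with $c\notin\{0,-1,-2,\dots\}$ and let $y(x):=\frac{x}{x-1}$. Then, as operators on $C^\omega$, $$(1-x)^{a}\,\mathcal{H}_c^a(x)\,(1-x)^{-c}=\mathcal{H}_c^a(y).$$
   Context: $C^\omega$ is the space of (germs of) functions analytic near $0\in\mathbb{C}$. $(q)_n=q(q+1)\cdots(q+n-1)$, $(q)_0=1$. For $a,c\in\mathbb{C}$ with $c\notin\{0,-1,-2,\dots\}$ the hypergeometrization is the linear operator $\mathcal{H}_c^a:C^\omega\to C^\omega$, $\mathcal{H}_c^a\left(\sum_n f_nx^n\right)=\sum_n f_n\frac{(a)_n}{(c)_n}x^n$; it is also denoted $\mathcal{H}_c^a(x)$. If $y=y(x)$ is analytic near $0$ with $y(0)=0$, $y'(0)\neq0$, then every $f\in C^\omega$ is uniquely $f=g\circ y$ with $g\in C^\omega$, and $\mathcal{H}_c^a(y)f:=(\mathcal{H}_c^a g)\circ y$. A function $h\in C^\omega$ written in an operator expression denotes multiplication by $h$, and juxtaposition denotes composition. Complex powers of functions equal to $1$ at $0$ are the branches with value $1$ at $0$. *)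

(* Defs.v *)
From Stdlib Require Import Reals ClassicalEpsilon.
From Coquelicot Require Import Coquelicot.
Open Scope C_scope.

(* Germs at 0 are represented by total functions C -> C, compared with
   [germ_eq]; their values away from 0 are irrelevant. *)
Definition germ_eq (f g : C -> C) : Prop :=
  locally (T := C_UniformSpace) (RtoC 0) (fun x => f x = g x).

(* f(x) = sum_n u_n x^n for all x near 0. *)
Definition expands (f : C -> C) (u : nat -> C) : Prop :=
  locally (T := C_UniformSpace) (RtoC 0)
    (fun x => is_pseries (K := C_AbsRing) (V := C_NormedModule) u x (f x)).

Definition analytic0 (f : C -> C) : Prop := exists u, expands f u.

(* Meaningful when [analytic0 f]; the expansion is then unique. *)
Definition coefs (f : C -> C) : nat -> C :=
  epsilon (inhabits (fun _ => RtoC 0)) (expands f).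

(* Total sum of a complex series; it is the limit whenever the series
   converges. *)
Definition CSeries (u : nat -> C) : C :=
  (Series (fun n => Re (u n)), Series (fun n => Im (u n))).

Fixpoint poch (q : C) (n : nat) : C :=
  match n with
  | O => 1
  | S m => poch q m * (q + INR m)
  end.

Definition operator := (C -> C) -> (C -> C).

Definition hypergeom (a c : C) : operator := fun f x =>
  CSeries (fun n => coefs f n * (poch a n / poch c n) * x ^ n).

(* The germ g with f = g o y; it exists and is unique when f and y are analytic
   near 0, y(0) = 0 and y'(0) <> 0. *)
Definition factor_through (y f : C -> C) : C -> C :=
  epsilon (inhabits (fun _ => RtoC 0))
    (fun g => analytic0 g /\ germ_eq f (fun x => g (y x))).

Definition hypergeom_along (a c : C) (y : C -> C) : operator := fun f x =>
  hypergeom a c (factor_through y f) (y x).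

Definition mult_op (h : C -> C) : operator := fun f x => h x * f x.

Definition op_comp (A B : operator) : operator := fun f => A (B f).

(* Equality as maps from analytic germs to analytic germs. *)
Definition op_eq (A B : operator) : Prop :=
  forall f, analytic0 f ->
    analytic0 (A f) /\ analytic0 (B f) /\ germ_eq (A f) (B f).

Definition Cexp (z : C) : C :=
  ((exp (Re z) * cos (Im z))%R, (exp (Re z) * sin (Im z))%R).

(* Principal argument, in (-PI, PI] for z <> 0. *)
Definition Carg (z : C) : R :=
  if Rle_dec 0 (Im z) then acos (Re z / Cmod z) else (- acos (Re z / Cmod z))%R.

Definition Clog (z : C) : C := (ln (Cmod z), Carg z).

(* Principal branch of z^q: analytic near z = 1, with value 1 there, hence
   h(x)^q is the branch with value 1 at x = 0 whenever h(0) = 1. *)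
Definition Cpower (z q : C) : C := Cexp (q * Clog z).

(* Main.v *)
Require Import Defs.
From Stdlib Require Import Reals Lra Lia Factorial ClassicalEpsilon.
From Coquelicot Require Import Coquelicot.
Open Scope C_scope.

(** Let [y = x / (x - 1)] and write [f = g o y] with [g = sum g_k y^k]. Since
[y^k = (-1)^k x^k (1 - x)^(-k)], multiplying by [(1 - x)^(-q)] gives
[sum_k g_k (-1)^k x^k (1 - x)^(-q-k)], and the binomial series turns this into
the power series with coefficients
[sum_(k <= n) g_k (-1)^k (q + k)_(n-k) / (n-k)!], called [reflect_coef q g].
For [q = c], this is the expansion of [(1 - x)^(-c) f]. Applying [H_c^a]
multiplies the coefficient of [x^n] by [(a)_n / (c)_n], and
[(c + k)_(n-k) (a)_n / (c)_n = (a + k)_(n-k) (a)_k / (c)_k], so the result is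
[reflect_coef a] of the sequence [g_k (a)_k / (c)_k] ([hyp_coef_reflect]).
That is the expansion of [(1 - x)^(-a) (H_c^a g)(y)], and multiplying by
[(1 - x)^a] ends the proof.

The analytic content is [expands_reflect]: [reflect_coef q g] does expand
[(1 - x)^(-q) g(y)]. The interchange of the sums over [k] and over the binomial
index is a dominated convergence argument on partial sums ([Tannery]). It needs
the series of [(1 - x)^(-q-k)] on one disc for all [k], with a bound geometric
in [k]; both come from the case [k = 0] by telescoping
([rbinom_sum_shift_lim], [rbinom_abs_sum_shift_bound]). The case [k = 0] is
[binomial_series], proved for the principal branch by a differential equation
along the segment from [0] to [x]. The operators are defined through coefficient
sequences, which are unique by [expands_unique]. *)

(** * Complex series and expansions of germs *)

Notation is_Cseries := (is_series (K := C_AbsRing) (V := C_NormedModule)).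

(** A wrapper whose result type is literally [C], which [ring] needs. *)
Definition Csum (u : nat -> C) (N : nat) : C :=
  sum_n (G := C_AbelianMonoid) u N.

Lemma Csum_S (u : nat -> C) N : Csum u (S N) = Csum u N + u (S N).
Proof. exact (sum_Sn (G := C_AbelianMonoid) u N). Qed.

Lemma Csum_O (u : nat -> C) : Csum u 0 = u 0%nat.
Proof. exact (sum_O (G := C_AbelianMonoid) u). Qed.

Lemma Rsum_S (u : nat -> R) N : sum_n u (S N) = (sum_n u N + u (S N))%R.
Proof. exact (sum_Sn u N). Qed.

Lemma Csum_scal (h : C) (u : nat -> C) N :
  Csum (fun k => h * u k) N = h * Csum u N.
Proof.
  induction N as [|N IH]; [rewrite !Csum_O | rewrite !Csum_S, IH]; ring.
Qed.

Lemma Csum_minus (u v : nat -> C) N :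
  Csum (fun k => u k - v k) N = Csum u N - Csum v N.
Proof.
  induction N as [|N IH]; [rewrite !Csum_O | rewrite !Csum_S, IH]; ring.
Qed.

Lemma Csum_ext_le (u v : nat -> C) N :
  (forall k, (k <= N)%nat -> u k = v k) -> Csum u N = Csum v N.
Proof.
  induction N as [|N IH]; intros H.
  - rewrite !Csum_O. apply H. lia.
  - rewrite !Csum_S, IH by (intros; apply H; lia). f_equal. apply H. lia.
Qed.

Lemma Csum_plus (u v : nat -> C) N :
  Csum (fun k => u k + v k) N = Csum u N + Csum v N.
Proof.
  induction N as [|N IH]; [rewrite !Csum_O | rewrite !Csum_S, IH]; ring.
Qed.

Lemma Cmod_Csum_le (u : nat -> C) (b : nat -> R) N :
  (forall k, (k <= N)%nat -> Cmod (u k) <= b k)%R ->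
  (Cmod (Csum u N) <= sum_n b N)%R.
Proof.
  induction N as [|N IH]; intros H.
  - rewrite Csum_O, sum_O. apply H; lia.
  - rewrite Csum_S, Rsum_S.
    eapply Rle_trans; [apply Cmod_triangle|].
    apply Rplus_le_compat; [apply IH; intros; apply H; lia | apply H; lia].
Qed.

(** Turns germs into statements about a disc for the modulus; [locally] on the
product [R * R] is phrased with squares. *)
Lemma locally0_iff (P : C -> Prop) :
  locally (T := C_UniformSpace) (RtoC 0) P <->
  exists r : R, (0 < r)%R /\ forall x, (Cmod x < r)%R -> P x.
Proof.
  assert (E : forall z : C, z - 0 = z) by (intros z; ring).
  split.
  - intros H.
    destruct (locally_norm_le_locally (V := C_NormedModule) (RtoC 0) P H)
      as [eps He].
    exists eps. split; [apply cond_pos|].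
    intros x Hx. apply He. change (Cmod (x - 0) < eps)%R.
    rewrite E. exact Hx.
  - intros [r [Hr H]].
    apply (locally_le_locally_norm (V := C_NormedModule) (RtoC 0) P).
    exists (mkposreal r Hr). intros x Hx. apply H.
    change (Cmod (x - 0) < r)%R in Hx.
    rewrite E in Hx. exact Hx.
Qed.

(** Convergence in [C] as a real limit, so that estimates on moduli apply
directly. *)
Definition Clim (u : nat -> C) (l : C) : Prop :=
  is_lim_seq (fun n => Cmod (u n - l)) 0.

Lemma is_Cseries_Clim (u : nat -> C) (l : C) :
  is_Cseries u l <-> Clim (Csum u) l.
Proof.
  unfold is_series, Clim.
  rewrite (filterlim_locally_ball_norm (K := C_AbsRing) (U := C_NormedModule)).
  rewrite <- is_lim_seq_spec. unfold is_lim_seq'. unfold ball_norm.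
  split; intros H eps; specialize (H eps); revert H; apply filter_imp;
    intros n Hn.
  - rewrite Rminus_0_r, Rabs_pos_eq by apply Cmod_ge_0. exact Hn.
  - rewrite Rminus_0_r, Rabs_pos_eq in Hn by apply Cmod_ge_0. exact Hn.
Qed.

Lemma is_lim_seq_0_le (u v : nat -> R) :
  (forall n, Rabs (u n) <= v n)%R -> is_lim_seq v 0 -> is_lim_seq u 0.
Proof.
  intros H Hv. apply is_lim_seq_abs_0.
  apply (is_lim_seq_le_le (fun _ => 0%R) _ v); [|apply is_lim_seq_const|exact Hv].
  intros n; split; [apply Rabs_pos | apply H].
Qed.

Lemma Clim_plus u v l m :
  Clim u l -> Clim v m -> Clim (fun n => u n + v n) (l + m).
Proof.
  intros Hu Hv. unfold Clim in *.
  apply is_lim_seq_0_le with (fun n => Cmod (u n - l) + Cmod (v n - m))%R.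
  - intros n. rewrite Rabs_pos_eq by apply Cmod_ge_0.
    eapply Rle_trans; [|apply Cmod_triangle]. right. f_equal. ring.
  - replace (Finite 0) with (Rbar_plus 0 0) by (simpl; f_equal; ring).
    apply is_lim_seq_plus'; assumption.
Qed.

Lemma Clim_scal h u l : Clim u l -> Clim (fun n => h * u n) (h * l).
Proof.
  intros Hu. unfold Clim in *.
  apply is_lim_seq_ext with (fun n => Cmod h * Cmod (u n - l))%R.
  - intros n. rewrite <- Cmod_mult. f_equal. ring.
  - replace (Finite 0) with (Rbar_mult (Cmod h) 0) by (simpl; f_equal; ring).
    apply is_lim_seq_scal_l. exact Hu.
Qed.

Lemma Clim_ext u v l : (forall n, u n = v n) -> Clim u l -> Clim v l.
Proof.
  intros H. apply is_lim_seq_ext. intros n. now rewrite H.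
Qed.

Lemma Clim_unique u l m : Clim u l -> Clim u m -> l = m.
Proof.
  intros Hl Hm.
  assert (H : Clim (fun n => u n + (-1) * u n) (l + (-1) * m))
    by (apply Clim_plus; [|apply Clim_scal]; assumption).
  assert (E : is_lim_seq (fun _ => Cmod (l - m)) 0).
  { revert H. apply is_lim_seq_ext. intros n.
    rewrite <- (Cmod_opp (l - m)). f_equal. ring. }
  assert (Z : Cmod (l - m) = 0%R).
  { apply is_lim_seq_unique in E. rewrite Lim_seq_const in E. congruence. }
  apply Cmod_eq_0 in Z. replace l with (l - m + m) by ring. rewrite Z. ring.
Qed.

Lemma Re_Csum (u : nat -> C) N : Re (Csum u N) = sum_n (fun n => Re (u n)) N.
Proof.
  induction N as [|N IH]; [now rewrite Csum_O, sum_O|].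
  now rewrite Csum_S, Rsum_S, re_plus, IH.
Qed.

Lemma Im_Csum (u : nat -> C) N : Im (Csum u N) = sum_n (fun n => Im (u n)) N.
Proof.
  induction N as [|N IH]; [now rewrite Csum_O, sum_O|].
  now rewrite Csum_S, Rsum_S, im_plus, IH.
Qed.

Lemma is_lim_seq_of_diff (u : nat -> R) (l : R) :
  is_lim_seq (fun n => u n - l)%R 0 -> is_lim_seq u l.
Proof.
  intros H.
  apply is_lim_seq_ext with (fun n => (u n - l) + l)%R; [intros; ring|].
  replace (Finite l) with (Rbar_plus 0 l) by (simpl; f_equal; ring).
  apply is_lim_seq_plus'; [exact H | apply is_lim_seq_const].
Qed.

Lemma is_Cseries_Re (u : nat -> C) l :
  is_Cseries u l -> is_series (fun n => Re (u n)) (Re l).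
Proof.
  intros H. apply is_Cseries_Clim in H.
  assert (G : is_lim_seq (sum_n (fun n => Re (u n))) (Re l)); [|exact G].
  apply is_lim_seq_of_diff. revert H. apply is_lim_seq_0_le. intros n.
  rewrite <- Re_Csum.
  eapply Rle_trans; [|apply re_le_Cmod]. right. f_equal.
Qed.

Lemma im_le_Cmod (z : C) : (Rabs (Im z) <= Cmod z)%R.
Proof. eapply Rle_trans; [apply Rmax_r | apply Rmax_Cmod]. Qed.

Lemma is_Cseries_Im (u : nat -> C) l :
  is_Cseries u l -> is_series (fun n => Im (u n)) (Im l).
Proof.
  intros H. apply is_Cseries_Clim in H.
  assert (G : is_lim_seq (sum_n (fun n => Im (u n))) (Im l)); [|exact G].
  apply is_lim_seq_of_diff. revert H. apply is_lim_seq_0_le. intros n.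
  rewrite <- Im_Csum.
  eapply Rle_trans; [|apply im_le_Cmod]. right. f_equal.
Qed.

Lemma is_Cseries_intro (u : nat -> C) (l : C) :
  is_series (fun n => Re (u n)) (Re l) -> is_series (fun n => Im (u n)) (Im l) ->
  is_Cseries u l.
Proof.
  intros H1 H2. apply is_Cseries_Clim. unfold Clim.
  assert (L1 : is_lim_seq (sum_n (fun n => Re (u n))) (Re l)) by exact H1.
  assert (L2 : is_lim_seq (sum_n (fun n => Im (u n))) (Im l)) by exact H2.
  apply is_lim_seq_0_le with (fun n => Rabs (sum_n (fun n => Re (u n)) n - Re l)
     + Rabs (sum_n (fun n => Im (u n)) n - Im l))%R.
  - intros n. rewrite Rabs_pos_eq by apply Cmod_ge_0.
    rewrite <- Re_Csum, <- Im_Csum.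
    destruct (Csum u n) as [a b], l as [c d]. simpl.
    replace ((a, b) - (c, d)) with (RtoC (a - c) + Ci * RtoC (b - d))
      by (apply injective_projections; simpl; ring).
    eapply Rle_trans; [apply Cmod_triangle|].
    rewrite Cmod_mult, !Cmod_R. right. f_equal.
    replace (Cmod Ci) with 1%R; [ring|].
    unfold Cmod, Ci; simpl. transitivity (sqrt 1);
      [symmetry; apply sqrt_1 | f_equal; ring].
  - assert (Z : forall u l, is_lim_seq u (Finite l) ->
      is_lim_seq (fun n => Rabs (u n - l))%R 0).
    { intros v m Hv. apply (proj1 (is_lim_seq_abs_0 _)).
      replace (Finite 0) with (Rbar_plus m (- m)%R) by (simpl; f_equal; ring).
      apply is_lim_seq_plus'; [exact Hv | apply is_lim_seq_const]. }
    replace (Finite 0) with (Rbar_plus 0 0) by (simpl; f_equal; ring).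
    apply is_lim_seq_plus'; now apply Z.
Qed.

Lemma CSeries_unique (u : nat -> C) l : is_Cseries u l -> CSeries u = l.
Proof.
  intros H. unfold CSeries.
  rewrite (is_series_unique _ _ (is_Cseries_Re _ _ H)).
  rewrite (is_series_unique _ _ (is_Cseries_Im _ _ H)).
  now destruct l.
Qed.

Lemma CSeries_correct (u : nat -> C) :
  ex_series (fun n => Cmod (u n)) -> is_Cseries u (CSeries u).
Proof.
  intros H.
  destruct (ex_series_le (K := C_AbsRing) (V := C_CompleteNormedModule)
              u (fun n => Cmod (u n))) as [l Hl].
  - intros n. apply Rle_refl.
  - exact H.
  - rewrite (CSeries_unique u l Hl). exact Hl.
Qed.

Lemma is_Cseries_ext (u v : nat -> C) l :
  (forall n, u n = v n) -> is_Cseries u l -> is_Cseries v l.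
Proof. intros H. apply is_series_ext. exact H. Qed.

Lemma pow_n_Cpow (x : C) n : pow_n (K := C_AbsRing) x n = x ^ n.
Proof. induction n as [|n IH]; [reflexivity|]. simpl. now rewrite IH. Qed.

Lemma expands_iff (f : C -> C) (u : nat -> C) :
  expands f u <->
  exists r : R, (0 < r)%R /\
    forall x, (Cmod x < r)%R -> is_Cseries (fun n => u n * x ^ n) (f x).
Proof.
  unfold expands. rewrite locally0_iff.
  split; intros [r [Hr H]]; exists r; split; try exact Hr; intros x Hx;
    specialize (H x Hx); revert H; apply is_Cseries_ext; intros n;
    [symmetry|]; (transitivity (x ^ n * u n);
      [ring | rewrite <- pow_n_Cpow; reflexivity]).
Qed.

(** The coefficient form of having a positive radius of convergence. *)
Definition geom_bounded (u : nat -> C) : Prop :=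
  exists M R : R, (0 < R)%R /\ forall n, (Cmod (u n) <= M * R ^ n)%R.

Lemma is_Cseries_terms_bounded (u : nat -> C) l :
  is_Cseries u l -> exists M : R, forall n, (Cmod (u n) <= M)%R.
Proof.
  intros H.
  destruct (filterlim_bounded (V := C_NormedModule) (Csum u)) as [M HM].
  { exists l. exact H. }
  assert (HM' : forall n, (Cmod (Csum u n) <= M)%R) by exact HM.
  exists (M + M)%R. intros [|n].
  - specialize (HM' 0%nat). rewrite Csum_O in HM'.
    pose proof (Cmod_ge_0 (u 0%nat)). lra.
  - replace (u (S n)) with (Csum u (S n) + - Csum u n)
      by (rewrite Csum_S; ring).
    eapply Rle_trans; [apply Cmod_triangle|]. rewrite Cmod_opp.
    apply Rplus_le_compat; apply HM'.
Qed.

Lemma Cmod_real_pos (r : R) : (0 <= r)%R -> Cmod (RtoC r) = r.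
Proof. intros H. rewrite Cmod_R. now apply Rabs_pos_eq. Qed.

(** Convergence at one point other than [0] already bounds the terms there. *)
Lemma expands_geom_bounded f u : expands f u -> geom_bounded u.
Proof.
  intros H. apply expands_iff in H. destruct H as [r [Hr H]].
  destruct (is_Cseries_terms_bounded _ _ (H (RtoC (r / 2)) ltac:(
     rewrite Cmod_real_pos; lra))) as [M HM].
  exists M, (/ (r / 2))%R. split; [apply Rinv_0_lt_compat; lra|].
  intros n. specialize (HM n).
  rewrite Cmod_mult, Cmod_pow, Cmod_real_pos in HM by lra.
  assert (P : (0 < (r / 2) ^ n)%R) by (apply pow_lt; lra).
  rewrite pow_inv.
  apply (Rmult_le_reg_r _ _ _ P).
  rewrite Rmult_assoc, Rinv_l, Rmult_1_r by lra. exact HM.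
Qed.

Lemma geom_bounded_summable (u : nat -> C) (M R : R) (x : C) :
  (0 < R)%R -> (forall n, (Cmod (u n) <= M * R ^ n)%R) -> (R * Cmod x < 1)%R ->
  ex_series (fun n => Cmod (u n * x ^ n)).
Proof.
  intros HR Hu Hx. pose proof (Cmod_ge_0 x) as Hx0.
  apply (ex_series_le (K := R_AbsRing) (V := R_CompleteNormedModule) _
           (fun n => M * (R * Cmod x) ^ n)%R).
  - intros n. change (norm (Cmod (u n * x ^ n)))
      with (Rabs (Cmod (u n * x ^ n))).
    rewrite Rabs_pos_eq by apply Cmod_ge_0.
    rewrite Cmod_mult, Cmod_pow, Rpow_mult_distr, <- Rmult_assoc.
    apply Rmult_le_compat_r; [apply pow_le; exact Hx0 | apply Hu].
  - apply (ex_series_scal M (fun n => (R * Cmod x) ^ n)%R).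
    apply ex_series_geom.
    rewrite Rabs_pos_eq; [exact Hx|]. apply Rmult_le_pos; lra.
Qed.

Lemma expands_CSeries (u : nat -> C) :
  geom_bounded u -> expands (fun x => CSeries (fun n => u n * x ^ n)) u.
Proof.
  intros [M [R [HR Hu]]]. apply expands_iff.
  exists (/ R)%R. split; [now apply Rinv_0_lt_compat|].
  intros x Hx. apply CSeries_correct.
  apply (geom_bounded_summable u M R); try assumption.
  apply (Rmult_lt_compat_l R) in Hx; [|exact HR].
  rewrite Rinv_r in Hx by lra. exact Hx.
Qed.

Lemma CV_radius_ge (b : nat -> R) (M r : R) :
  (forall n, Rabs (b n * r ^ n) <= M)%R -> Rbar_le r (CV_radius b).
Proof.
  intros H. apply (CV_radius_bounded b). exists M. exact H.
Qed.

(** Applied with [p := Re] and [p := Im]. *)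
Lemma CV_radius_part_pos (p : C -> R) (u : nat -> C) :
  (forall z, Rabs (p z) <= Cmod z)%R ->
  geom_bounded u -> Rbar_lt 0 (CV_radius (fun n => p (u n))).
Proof.
  intros Hp [M [R [HR Hu]]].
  apply Rbar_lt_le_trans with (Finite (/ R)).
  { simpl. now apply Rinv_0_lt_compat. }
  apply CV_radius_ge with M. intros n.
  assert (P : (0 < R ^ n)%R) by now apply pow_lt.
  rewrite pow_inv, Rabs_mult, (Rabs_pos_eq (/ R ^ n))
    by (left; now apply Rinv_0_lt_compat).
  apply (Rmult_le_reg_r _ _ _ P).
  rewrite Rmult_assoc, Rinv_l, Rmult_1_r by lra.
  eapply Rle_trans; [apply Hp | apply Hu].
Qed.

(** On the real axis the real and the imaginary part of the expansion are real
power series with coefficients [Re (u n)] and [Im (u n)], and uniqueness holds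
for those. *)
Lemma expands_unique f u v : expands f u -> expands f v -> forall n, u n = v n.
Proof.
  intros Hu Hv n.
  pose proof (expands_geom_bounded _ _ Hu) as Bu.
  pose proof (expands_geom_bounded _ _ Hv) as Bv.
  apply expands_iff in Hu. apply expands_iff in Hv.
  destruct Hu as [r [Hr Hu]]. destruct Hv as [s [Hs Hv]].
  assert (L : forall t : R, (Rabs (t - 0) < Rmin r s)%R ->
     (Cmod (RtoC t) < r)%R /\ (Cmod (RtoC t) < s)%R).
  { intros t Ht. rewrite Rminus_0_r in Ht. rewrite Cmod_R.
    pose proof (Rmin_l r s). pose proof (Rmin_r r s). lra. }
  assert (Hm : (0 < Rmin r s)%R) by now apply Rmin_pos.
  assert (ReE : Re (u n) = Re (v n)).
  { apply (PSeries_ext_recip (fun n => Re (u n)) (fun n => Re (v n)));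
      try (apply (CV_radius_part_pos Re); [apply re_le_Cmod | assumption]).
    exists (mkposreal _ Hm). intros t Ht. destruct (L t Ht) as [L1 L2].
    unfold PSeries.
    transitivity (Re (f t)); [|symmetry];
      apply is_series_unique;
      [pose proof (is_Cseries_Re _ _ (Hu _ L1)) as E
      |pose proof (is_Cseries_Re _ _ (Hv _ L2)) as E];
      revert E; apply is_series_ext; intros k;
      now rewrite <- RtoC_pow, re_scal_r. }
  assert (ImE : Im (u n) = Im (v n)).
  { apply (PSeries_ext_recip (fun n => Im (u n)) (fun n => Im (v n)));
      try (apply (CV_radius_part_pos Im); [apply im_le_Cmod | assumption]).
    exists (mkposreal _ Hm). intros t Ht. destruct (L t Ht) as [L1 L2].
    unfold PSeries.
    transitivity (Im (f t)); [|symmetry];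
      apply is_series_unique;
      [pose proof (is_Cseries_Im _ _ (Hu _ L1)) as E
      |pose proof (is_Cseries_Im _ _ (Hv _ L2)) as E];
      revert E; apply is_series_ext; intros k;
      now rewrite <- RtoC_pow, im_scal_r. }
  destruct (u n), (v n); simpl in *; congruence.
Qed.

Lemma coefs_expands f u : expands f u -> forall n, coefs f n = u n.
Proof.
  intros H. apply (expands_unique f); [|exact H].
  unfold coefs. apply epsilon_spec. now exists u.
Qed.

Lemma expands_germ f h u : germ_eq f h -> expands h u -> expands f u.
Proof.
  unfold germ_eq. rewrite locally0_iff, !expands_iff.
  intros [r [Hr E]] [s [Hs H]]. exists (Rmin r s).
  split; [now apply Rmin_pos|]. intros x Hx.
  apply Rmin_Rgt in Hx. rewrite E by apply Hx. now apply H.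
Qed.

Lemma expands_germ_eq f h u : expands f u -> expands h u -> germ_eq f h.
Proof.
  unfold germ_eq. rewrite locally0_iff, !expands_iff.
  intros [r [Hr E]] [s [Hs H]]. exists (Rmin r s).
  split; [now apply Rmin_pos|]. intros x Hx.
  apply Rmin_Rgt in Hx. destruct Hx as [H1 H2].
  rewrite <- (CSeries_unique _ _ (E x H1)). apply CSeries_unique. now apply H.
Qed.

Lemma CSeries_ext u v : (forall n, u n = v n) -> CSeries u = CSeries v.
Proof.
  intros H. unfold CSeries. f_equal; apply Series_ext; intros n; now rewrite H.
Qed.

Lemma expands_ext f u v : (forall n, u n = v n) -> expands f u -> expands f v.
Proof.
  intros H. unfold expands. apply filter_imp. intros x.
  apply is_pseries_ext. exact H.
Qed.

(** * Tannery's theorem *)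

Lemma Rsum_nonneg_mono (d : nat -> R) (K N : nat) :
  (forall k, 0 <= d k)%R ->
  (sum_n d N <= sum_n d (K + N))%R.
Proof.
  intros Hd. induction K as [|K IH]; [right; reflexivity|].
  change (S K + N)%nat with (S (K + N)). rewrite Rsum_S.
  specialize (Hd (S (K + N))). lra.
Qed.

Lemma Rsum_le (u v : nat -> R) N :
  (forall k, (k <= N)%nat -> u k <= v k)%R -> (sum_n u N <= sum_n v N)%R.
Proof.
  induction N as [|N IH]; intros H.
  - rewrite !sum_O. apply H. lia.
  - rewrite !Rsum_S. apply Rplus_le_compat; [apply IH; intros; apply H; lia|].
    apply H; lia.
Qed.

Lemma Rsum_minus_le (u v : nat -> R) K j :
  (forall k, u k <= v k)%R ->
  (sum_n u (K + j) - sum_n u K <= sum_n v (K + j) - sum_n v K)%R.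
Proof.
  intros H. induction j as [|j IH].
  - rewrite Nat.add_0_r. lra.
  - rewrite Nat.add_succ_r, !Rsum_S. specialize (H (S (K + j))). lra.
Qed.

Lemma lim_finite_sum (d : nat -> nat -> R) (K : nat) :
  (forall k, is_lim_seq (fun N => d N k) 0) ->
  is_lim_seq (fun N => sum_n (d N) K) 0.
Proof.
  intros H. induction K as [|K IH].
  - apply is_lim_seq_ext with (fun N => d N 0%nat); [|apply H].
    intros N. now rewrite sum_O.
  - apply is_lim_seq_ext with (fun N => sum_n (d N) K + d N (S K))%R.
    { intros N. now rewrite Rsum_S. }
    replace (Finite 0) with (Rbar_plus 0 0) by (simpl; f_equal; ring).
    apply is_lim_seq_plus'; [exact IH | apply H].
Qed.

(** Choose [K] with the tail of [D] beyond [K] below [eps / 2]; the terms of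
index at most [K] are finitely many and tend to [0] together. *)
Lemma dominated_lim_0 (d : nat -> nat -> R) (D : nat -> R) :
  (forall N k, 0 <= d N k <= D k)%R -> ex_series D ->
  (forall k, is_lim_seq (fun N => d N k) 0) ->
  is_lim_seq (fun N => sum_n (d N) N) 0.
Proof.
  intros Hd [L HL] Hk.
  assert (HL' : is_lim_seq (sum_n D) L) by exact HL.
  assert (D0 : forall k, (0 <= D k)%R).
  { intros k. specialize (Hd 0%nat k). lra. }
  assert (HU : forall N, (sum_n D N <= L)%R).
  { intros N. apply (is_lim_seq_incr_compare (sum_n D) L HL').
    intros n. rewrite Rsum_S. specialize (D0 (S n)). lra. }
  apply is_lim_seq_spec. intros eps.
  apply is_lim_seq_spec in HL'.
  destruct (HL' (pos_div_2 eps)) as [K HK].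
  specialize (HK K (le_n K)). simpl in HK.
  pose proof (lim_finite_sum d K Hk) as HF.
  apply is_lim_seq_spec in HF.
  destruct (HF (pos_div_2 eps)) as [N0 HN0].
  exists N0. intros N HN. specialize (HN0 N HN). simpl in HN0.
  rewrite Rminus_0_r in *.
  assert (P : forall n, (0 <= sum_n (d N) n)%R).
  { intros n. induction n as [|n IH].
    - rewrite sum_O. apply Hd.
    - rewrite Rsum_S. specialize (Hd N (S n)). lra. }
  rewrite Rabs_pos_eq in HN0 by apply P. rewrite Rabs_pos_eq by apply P.
  pose proof (Rsum_nonneg_mono (d N) K N (fun k => proj1 (Hd N k))) as H1.
  pose proof (Rsum_minus_le (d N) D K N (fun k => proj2 (Hd N k))) as H2.
  pose proof (HU (K + N)%nat) as H3.
  apply Rabs_def2 in HK. lra.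
Qed.

(** Dominated convergence for series, in the triangular form where the range of
summation grows with [N]. It replaces the interchange of two infinite sums. *)
Lemma Tannery (w : nat -> nat -> C) (l : nat -> C) (D : nat -> R) (L : C) :
  (forall N k, (Cmod (w N k) <= D k)%R) -> ex_series D ->
  (forall k, Clim (fun N => w N k) (l k)) -> is_Cseries l L ->
  Clim (fun N => Csum (w N) N) L.
Proof.
  intros Hw HD Hl HL.
  assert (HlD : forall k, (Cmod (l k) <= D k)%R).
  { intros k.
    apply (is_lim_seq_le (fun _ => Cmod (l k))
             (fun N => Cmod (w N k - l k) + D k)%R (Cmod (l k)) (D k)).
    - intros N. replace (l k) with (- (w N k - l k) + w N k) at 1 by ring.
      eapply Rle_trans; [apply Cmod_triangle|]. rewrite Cmod_opp.
      apply Rplus_le_compat_l, Hw.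
    - apply is_lim_seq_const.
    - replace (Finite (D k)) with (Rbar_plus 0 (D k)) by (simpl; f_equal; ring).
      apply is_lim_seq_plus'; [apply Hl | apply is_lim_seq_const]. }
  assert (H0 : Clim (fun N => Csum (fun k => w N k - l k) N) 0).
  { unfold Clim.
    apply is_lim_seq_0_le with (fun N => sum_n (fun k => Cmod (w N k - l k)) N).
    - intros N. rewrite Rabs_pos_eq by apply Cmod_ge_0.
      replace (Csum (fun k => w N k - l k) N - 0)
        with (Csum (fun k => w N k - l k) N) by ring.
      apply Cmod_Csum_le. intros; apply Rle_refl.
    - apply (dominated_lim_0 (fun N k => Cmod (w N k - l k))
               (fun k => D k + D k)%R).
      + intros N k. split; [apply Cmod_ge_0|].
        eapply Rle_trans; [apply Cmod_triangle|]. rewrite Cmod_opp.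
        apply Rplus_le_compat; [apply Hw | apply HlD].
      + apply (ex_series_plus D D HD HD).
      + exact Hl. }
  apply is_Cseries_Clim in HL.
  pose proof (Clim_plus _ _ _ _ H0 HL) as H.
  replace (0 + L) with L in H by ring.
  revert H. apply Clim_ext. intros N. rewrite Csum_minus. ring.
Qed.

(** * Binomial coefficients and partial binomial sums *)

Lemma INR_fact_neq_0_C n : RtoC (INR (fact n)) <> 0.
Proof. intros H. apply RtoC_inj in H. now apply (INR_fact_neq_0 n). Qed.

Lemma INR_S_neq_0_C n : RtoC (INR (S n)) <> 0.
Proof. intros H. apply RtoC_inj in H. now apply (not_0_INR (S n)). Qed.

Lemma RtoC_INR_S n : RtoC (INR (S n)) = INR n + 1.
Proof. now rewrite S_INR, RtoC_plus. Qed.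

Lemma RtoC_INR_fact_S n :
  RtoC (INR (fact (S n))) = (INR n + 1) * INR (fact n).
Proof.
  change (fact (S n)) with (S n * fact n)%nat.
  now rewrite mult_INR, RtoC_mult, RtoC_INR_S.
Qed.

Lemma poch_add q k m : poch q (k + m) = poch q k * poch (q + INR k) m.
Proof.
  induction m as [|m IH]; [rewrite Nat.add_0_r; simpl; ring|].
  rewrite Nat.add_succ_r. simpl poch. rewrite IH, plus_INR, RtoC_plus. ring.
Qed.

(** The coefficients of [(1 - x)^(-q)]. *)
Definition rbinom (q : C) (n : nat) : C := poch q n / INR (fact n).

Lemma rbinom_0 q : rbinom q 0 = 1.
Proof. unfold rbinom. simpl. field. Qed.

Lemma rbinom_S q n : INR (S n) * rbinom q (S n) = (q + INR n) * rbinom q n.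
Proof.
  unfold rbinom. rewrite RtoC_INR_fact_S, RtoC_INR_S. simpl poch. field.
  split; [apply INR_fact_neq_0_C|]. rewrite <- RtoC_INR_S. apply INR_S_neq_0_C.
Qed.

Lemma rbinom_pascal q n :
  rbinom (q + 1) (S n) = rbinom (q + 1) n + rbinom q (S n).
Proof.
  unfold rbinom.
  pose proof (poch_add q 1 n) as E. simpl (1 + n)%nat in E.
  rewrite E, RtoC_INR_fact_S. simpl.
  field.
  split; [apply INR_fact_neq_0_C|]. rewrite <- RtoC_INR_S. apply INR_S_neq_0_C.
Qed.

Lemma rbinom_bound q n : (Cmod (rbinom q n) <= (1 + Cmod q) ^ n)%R.
Proof.
  pose proof (Cmod_ge_0 q) as Hq.
  induction n as [|n IH].
  - rewrite rbinom_0, Cmod_1. simpl. lra.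
  - pose proof (pos_INR n) as Hn.
    assert (Hs : (0 < INR (S n))%R) by (rewrite S_INR; lra).
    apply (Rmult_le_reg_l _ _ _ Hs).
    replace (INR (S n) * Cmod (rbinom q (S n)))%R
      with (Cmod (INR (S n) * rbinom q (S n)))
      by (rewrite Cmod_mult, Cmod_real_pos; lra).
    rewrite rbinom_S, Cmod_mult.
    assert (H : (Cmod (q + INR n) <= INR (S n) * (1 + Cmod q))%R).
    { eapply Rle_trans; [apply Cmod_triangle|].
      rewrite Cmod_real_pos, S_INR by exact Hn. nra. }
    simpl pow. rewrite <- Rmult_assoc.
    apply Rmult_le_compat; try apply Cmod_ge_0; assumption.
Qed.

Definition rbinom_sum (q x : C) (m : nat) : C :=
  Csum (fun j => rbinom q j * x ^ j) m.
Definition rbinom_abs_sum (q x : C) (m : nat) : R :=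
  sum_n (fun j => Cmod (rbinom q j * x ^ j)) m.

(** [(1 - x) (1 - x)^(-q-1) = (1 - x)^(-q)] at the level of partial sums. *)
Lemma rbinom_sum_telescope q x m :
  rbinom_sum (q + 1) x m * (1 - x) =
    rbinom_sum q x m - x * (rbinom (q + 1) m * x ^ m).
Proof.
  unfold rbinom_sum. induction m as [|m IH].
  - rewrite !Csum_O, !rbinom_0. simpl. ring.
  - rewrite !Csum_S, Cmult_plus_distr_r, IH, rbinom_pascal. simpl. ring.
Qed.

(** Pascal's rule and the triangle inequality give the telescoping for sums of
moduli too, as an inequality. *)
Lemma rbinom_abs_sum_telescope q x m :
  (rbinom_abs_sum (q + 1) x m * (1 - Cmod x)
     + Cmod x * Cmod (rbinom (q + 1) m * x ^ m)
     <= rbinom_abs_sum q x m)%R.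
Proof.
  unfold rbinom_abs_sum. induction m as [|m IH].
  - rewrite !sum_O, !rbinom_0. simpl. rewrite Cmult_1_l, Cmod_1. lra.
  - rewrite !Rsum_S, Rmult_plus_distr_r.
    assert (H : (Cmod (rbinom (q + 1) (S m) * x ^ S m)
        <= Cmod x * Cmod (rbinom (q + 1) m * x ^ m)
           + Cmod (rbinom q (S m) * x ^ S m))%R).
    { rewrite rbinom_pascal. rewrite <- Cmod_mult.
      eapply Rle_trans; [|apply Cmod_triangle]. right. f_equal. simpl. ring. }
    lra.
Qed.

(** The bound [rbinom_bound] degrades with the parameter, so the disc where it
gives convergence shrinks as [k] grows. Telescoping from [q] keeps one disc for
all [k] and costs only a geometric factor. *)
Lemma rbinom_abs_sum_shift_bound q x M k m :
  (Cmod x < 1)%R -> (forall m, rbinom_abs_sum q x m <= M)%R ->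
  (rbinom_abs_sum (q + INR k) x m <= M * (/ (1 - Cmod x)) ^ k)%R.
Proof.
  intros Hx HM. revert m. induction k as [|k IH]; intros m.
  - simpl. replace (q + 0) with q by ring. rewrite Rmult_1_r. apply HM.
  - rewrite RtoC_INR_S, Cplus_assoc.
    pose proof (rbinom_abs_sum_telescope (q + INR k) x m) as H.
    pose proof (Rmult_le_pos _ _ (Cmod_ge_0 x)
      (Cmod_ge_0 (rbinom (q + INR k + 1) m * x ^ m))) as P.
    specialize (IH m). simpl.
    apply (Rmult_le_reg_r (1 - Cmod x)); [lra|].
    replace (M * (/ (1 - Cmod x) * (/ (1 - Cmod x)) ^ k) * (1 - Cmod x))%R
      with (M * (/ (1 - Cmod x)) ^ k)%R by (field; lra).
    lra.
Qed.

Lemma rbinom_sum_le_abs_sum q x m :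
  (Cmod (rbinom_sum q x m) <= rbinom_abs_sum q x m)%R.
Proof. apply Cmod_Csum_le. intros; apply Rle_refl. Qed.

Lemma lim_0_of_bounded_sums (u : nat -> R) (M : R) :
  (forall n, 0 <= u n)%R -> (forall n, sum_n u n <= M)%R -> is_lim_seq u 0.
Proof.
  intros Hu HM. apply ex_series_lim_0.
  destruct (ex_finite_lim_seq_incr (sum_n u) M) as [l Hl].
  - intros n. rewrite Rsum_S. specialize (Hu (S n)). lra.
  - exact HM.
  - exists l. exact Hl.
Qed.

(** Telescoping derives the binomial series for all exponents [-q-k] from the one
for [-q], on the same disc. *)
Lemma rbinom_sum_shift_lim q x B M k :
  (Cmod x < 1)%R -> (forall m, rbinom_abs_sum q x m <= M)%R ->
  Clim (rbinom_sum q x) B ->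
  Clim (rbinom_sum (q + INR k) x) (B * (/ (1 - x)) ^ k).
Proof.
  intros Hx HM HB.
  assert (Hx1 : 1 - x <> 0).
  { intros E. replace x with (RtoC 1) in Hx.
    - rewrite Cmod_1 in Hx. lra.
    - replace x with (1 - (1 - x)) by ring. rewrite E. ring. }
  induction k as [|k IH].
  - simpl. replace (q + 0) with q by ring. now rewrite Cmult_1_r.
  - rewrite RtoC_INR_S, Cplus_assoc.
    assert (T : Clim (fun m => rbinom (q + INR k + 1) m * x ^ m) 0).
    { unfold Clim.
      apply is_lim_seq_ext with
        (fun m => Cmod (rbinom (q + INR k + 1) m * x ^ m)).
      { intros m. f_equal. ring. }
      apply lim_0_of_bounded_sums with (M * (/ (1 - Cmod x)) ^ S k)%R.
      - intros n. apply Cmod_ge_0.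
      - intros n. rewrite <- Cplus_assoc, <- RtoC_INR_S.
        now apply rbinom_abs_sum_shift_bound. }
    pose proof (Clim_plus _ _ _ _ IH (Clim_scal (- x) _ _ T)) as H.
    apply (Clim_scal (/ (1 - x))) in H.
    replace (/ (1 - x) * (B * (/ (1 - x)) ^ k + - x * 0))
      with (B * (/ (1 - x)) ^ S k) in H by (simpl; ring).
    revert H. apply Clim_ext. intros m.
    replace (rbinom_sum (q + INR k) x m
        + - x * (rbinom (q + INR k + 1) m * x ^ m))
      with (rbinom_sum (q + INR k + 1) x m * (1 - x))
      by (rewrite rbinom_sum_telescope; ring).
    field. exact Hx1.
Qed.

(** * The binomial series for the principal branch *)

(** Componentwise, so that the real differentiation rules and the constancy of
real functions with zero derivative apply. *)
Definition is_ray_derive (f : R -> C) (t : R) (d : C) : Prop :=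
  is_derive (fun s => Re (f s)) t (Re d) /\
  is_derive (fun s => Im (f s)) t (Im d).

Lemma is_derive_eq (f : R -> R) (t d d' : R) :
  is_derive f t d -> d = d' -> is_derive f t d'.
Proof. intros H <-. exact H. Qed.

Lemma is_ray_derive_mult f g t df dg :
  is_ray_derive f t df -> is_ray_derive g t dg ->
  is_ray_derive (fun s => f s * g s) t (df * g t + f t * dg).
Proof.
  intros [f1 f2] [g1 g2]. split.
  - apply is_derive_ext with
      (fun s => Re (f s) * Re (g s) - Im (f s) * Im (g s))%R; [reflexivity|].
    eapply is_derive_eq.
    + apply (is_derive_minus _ _ _ _ _
        (is_derive_mult _ _ _ _ _ f1 g1 Rmult_comm)
        (is_derive_mult _ _ _ _ _ f2 g2 Rmult_comm)).
    + rewrite re_plus, !re_mult. unfold minus, plus, opp, mult; simpl. ring.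
  - apply is_derive_ext with
      (fun s => Re (f s) * Im (g s) + Im (f s) * Re (g s))%R; [reflexivity|].
    eapply is_derive_eq.
    + apply (is_derive_plus _ _ _ _ _
        (is_derive_mult _ _ _ _ _ f1 g2 Rmult_comm)
        (is_derive_mult _ _ _ _ _ f2 g1 Rmult_comm)).
    + rewrite im_plus, !im_mult. unfold plus, mult; simpl. ring.
Qed.

Lemma is_ray_derive_const (z : C) t : is_ray_derive (fun _ => z) t 0.
Proof. split; apply (is_derive_const (K := R_AbsRing) (V := R_NormedModule)). Qed.

Lemma is_ray_derive_exp f t d :
  is_ray_derive f t d ->
  is_ray_derive (fun s => Cexp (f s)) t (d * Cexp (f t)).
Proof.
  intros [H1 H2].
  pose proof (is_derive_comp exp _ t _ _ (is_derive_exp _) H1) as E.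
  pose proof (is_derive_comp cos _ t _ _ (is_derive_cos _) H2) as Co.
  pose proof (is_derive_comp sin _ t _ _ (is_derive_sin _) H2) as Si.
  split.
  - apply is_derive_ext with
      (fun s => exp (Re (f s)) * cos (Im (f s)))%R; [reflexivity|].
    eapply is_derive_eq.
    + apply (is_derive_mult _ _ _ _ _ E Co Rmult_comm).
    + rewrite re_mult. unfold Cexp, plus, mult, scal; simpl.
      unfold mult; simpl. ring.
  - apply is_derive_ext with
      (fun s => exp (Re (f s)) * sin (Im (f s)))%R; [reflexivity|].
    eapply is_derive_eq.
    + apply (is_derive_mult _ _ _ _ _ E Si Rmult_comm).
    + rewrite im_mult. unfold Cexp, plus, mult, scal; simpl.
      unfold mult; simpl. ring.
Qed.

(** In the right half-plane the principal argument is given by one smooth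
formula, so it can be differentiated across the real axis, where the definition
of [Carg] changes case. *)
Lemma Carg_atan (z : C) : (0 < Re z)%R -> Carg z = atan (Im z / Re z).
Proof.
  destruct z as [u v]. simpl. intros Hu.
  assert (Hm : (0 < u ^ 2 + v ^ 2)%R) by nra.
  assert (Hs : (0 < sqrt (u ^ 2 + v ^ 2))%R) by now apply sqrt_lt_R0.
  assert (E : acos (u / Cmod (u, v)) = atan (Rabs v / u)).
  { unfold Cmod; simpl fst; simpl snd.
    rewrite acos_atan by now apply Rdiv_lt_0_compat.
    f_equal.
    replace (1 - (u / sqrt (u ^ 2 + v ^ 2))²)%R
      with ((Rabs v / sqrt (u ^ 2 + v ^ 2))²)%R.
    - rewrite sqrt_Rsqr.
      + field. split; lra.
      + apply Rmult_le_pos; [apply Rabs_pos|]. left. now apply Rinv_0_lt_compat.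
    - unfold Rdiv. rewrite !Rsqr_mult, <- Rsqr_abs.
      rewrite Rsqr_inv', Rsqr_sqrt by lra. unfold Rsqr. field. lra. }
  unfold Carg. simpl Im. simpl Re. rewrite E.
  destruct (Rle_dec 0 v) as [Hv|Hv].
  - now rewrite Rabs_pos_eq.
  - rewrite Rabs_left by lra. rewrite <- atan_opp. f_equal. field. lra.
Qed.

Lemma is_ray_derive_log (x : C) (t : R) :
  (Cmod x <= / 2)%R -> (0 <= t <= 1)%R ->
  is_ray_derive (fun s => Clog (1 - s * x)) t (- x / (1 - t * x)).
Proof.
  intros Hx Ht.
  pose proof (re_le_Cmod x) as Hp. destruct x as [p r]. simpl Re in Hp.
  assert (Hpos : forall s, (Rabs (s - t) < 1)%R -> (0 < 1 - s * p)%R).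
  { intros s Hs. apply Rabs_def2 in Hs.
    assert (Hp' : (- / 2 <= p <= / 2)%R) by (apply Rabs_le_between; lra).
    nra. }
  assert (H0 : (0 < 1 - t * p)%R).
  { apply Hpos. rewrite Rminus_eq_0, Rabs_R0. lra. }
  assert (Hsq : (0 < (1 - t * p) ^ 2 + (t * r) ^ 2)%R) by nra.
  assert (E : - (p, r) / (1 - t * (p, r)) =
    (((- p * (1 - t * p) + t * r * r) / ((1 - t * p) ^ 2 + (t * r) ^ 2))%R,
     (- r / ((1 - t * p) ^ 2 + (t * r) ^ 2))%R)).
  { unfold Cdiv, Cinv, Cmult, Cminus, Cplus, Copp, RtoC; simpl.
    f_equal; field; nra. }
  rewrite E. split; cbn [Re Im fst snd].
  - apply is_derive_ext with
      (fun s => ln (sqrt ((1 - s * p) ^ 2 + (s * r) ^ 2))).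
    { intros s. unfold Clog, Cmod. simpl. f_equal. f_equal. ring. }
    auto_derive.
    + assert (Hs : (0 < (1 + - (t * p)) * ((1 + - (t * p)) * 1)
                       + t * r * (t * r * 1))%R) by nra.
      repeat split; try exact Hs. now apply sqrt_lt_R0.
    + assert (Hr : (0 < sqrt ((1 - t * p) ^ 2 + (t * r) ^ 2))%R)
        by now apply sqrt_lt_R0.
      replace ((1 + - (t * p)) * ((1 + - (t * p)) * 1) + t * r * (t * r * 1))%R
        with ((1 - t * p) ^ 2 + (t * r) ^ 2)%R by ring.
      set (W := ((1 - t * p) ^ 2 + (t * r) ^ 2)%R) in *.
      pose proof (sqrt_sqrt W (Rlt_le _ _ Hsq)) as Q.
      transitivity ((- p * (1 - t * p) + t * r * r) / (sqrt W * sqrt W))%R;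
        [field; lra | now rewrite Q].
  - apply is_derive_ext_loc with (fun s => atan (- (s * r) / (1 - s * p))).
    + exists (mkposreal 1 Rlt_0_1). intros s Hs.
      change (Im (Clog (1 - s * (p, r)))) with (Carg (1 - s * (p, r))).
      assert (Hs' : (0 < 1 - s * p)%R) by now apply Hpos.
      rewrite Carg_atan.
      * f_equal. simpl. field. lra.
      * simpl. lra.
    + auto_derive; [lra|]. field. split; [|lra]. nra.
Qed.

Lemma Cexp_0 : Cexp 0 = 1.
Proof.
  unfold Cexp. simpl. rewrite exp_0, cos_0, sin_0. unfold RtoC. f_equal; ring.
Qed.

Lemma Cexp_plus z w : Cexp (z + w) = Cexp z * Cexp w.
Proof.
  destruct z, w. unfold Cexp, Cmult; simpl. rewrite exp_plus, cos_plus, sin_plus.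
  f_equal; ring.
Qed.

Lemma Cpower_opp z q : Cpower z q * Cpower z (- q) = 1.
Proof.
  unfold Cpower. rewrite <- Cexp_plus, <- Cexp_0. f_equal. ring.
Qed.

Lemma Cpower_0 z : Cpower z 0 = 1.
Proof. unfold Cpower. rewrite Cmult_0_l. exact Cexp_0. Qed.

(** Along real [t], the real and imaginary parts of [sum b_n t^n] are real power
series, whose radius is at least [2] here; so they may be differentiated term by
term on [[-1, 1]]. *)
Lemma ray_power_series (b : nat -> C) (M : R) :
  (forall n, Cmod (b n) <= M * (/ 2) ^ n)%R ->
  exists B D : R -> C, forall t, (Rabs t <= 1)%R ->
    is_Cseries (fun n => b n * RtoC t ^ n) (B t) /\
    is_Cseries (fun n => INR (S n) * b (S n) * RtoC t ^ n) (D t) /\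
    is_ray_derive B t (D t).
Proof.
  intros Hb.
  assert (CV : forall p : C -> R, (forall z, Rabs (p z) <= Cmod z)%R ->
    Rbar_le 2 (CV_radius (fun n => p (b n)))).
  { intros p Hp. apply CV_radius_ge with M. intros n.
    assert (P : (0 < 2 ^ n)%R) by (apply pow_lt; lra).
    rewrite Rabs_mult, (Rabs_pos_eq (2 ^ n)) by lra.
    eapply Rle_trans.
    - apply Rmult_le_compat_r; [lra|]. eapply Rle_trans; [apply Hp | apply Hb].
    - rewrite pow_inv. right. field. lra. }
  exists (fun t => (PSeries (fun n => Re (b n)) t,
               PSeries (fun n => Im (b n)) t)),
    (fun t => (PSeries (PS_derive (fun n => Re (b n))) t,
               PSeries (PS_derive (fun n => Im (b n))) t)).
  intros t Ht.
  assert (CVt : forall p : C -> R, (forall z, Rabs (p z) <= Cmod z)%R ->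
    Rbar_lt (Rabs t) (CV_radius (fun n => p (b n)))).
  { intros p Hp. apply Rbar_lt_le_trans with (Finite 2); [simpl; lra|].
    now apply CV. }
  pose proof (CVt Re re_le_Cmod) as CVRe. pose proof (CVt Im im_le_Cmod) as CVIm.
  assert (S0 : forall a : nat -> R, Rbar_lt (Rabs t) (CV_radius a) ->
    is_series (fun n => a n * t ^ n)%R (PSeries a t)).
  { intros a Ha. apply Series_correct, ex_series_Rabs, CV_disk_inside, Ha. }
  split; [|split].
  - apply is_Cseries_intro;
      [ apply is_series_ext with (fun n => Re (b n) * t ^ n)%R
      | apply is_series_ext with (fun n => Im (b n) * t ^ n)%R ];
      try (now apply S0); intros n; rewrite <- RtoC_pow.
    + now rewrite re_scal_r.
    + now rewrite im_scal_r.
  - apply is_Cseries_intro;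
      [ apply is_series_ext with
          (fun n => PS_derive (fun n => Re (b n)) n * t ^ n)%R
      | apply is_series_ext with
          (fun n => PS_derive (fun n => Im (b n)) n * t ^ n)%R ];
      try (apply S0; now rewrite CV_radius_derive);
      intros n; rewrite <- RtoC_pow; unfold PS_derive.
    + now rewrite re_scal_r, re_scal_l.
    + now rewrite im_scal_r, im_scal_l.
  - split; simpl Re; simpl Im; now apply is_derive_PSeries.
Qed.

(** Along the ray [t |-> t x] the sum [B] of the series satisfies
[(1 - t x) B' = q x B], by the recurrence of its coefficients. The function
[(1 - t x)^q] has the opposite logarithmic derivative, so the product of the two
is constant; it is [1] at [t = 0], and [t = 1] is the claim. *)
Lemma binomial_series (q x : C) :
  ((1 + Cmod q) * Cmod x <= / 2)%R ->
  is_Cseries (fun n => rbinom q n * x ^ n) (Cpower (1 - x) (- q)).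
Proof.
  intros Hx.
  pose proof (Cmod_ge_0 q) as Hq0. pose proof (Cmod_ge_0 x) as Hx0.
  assert (Hx2 : (Cmod x <= / 2)%R) by nra.
  destruct (ray_power_series (fun n => rbinom q n * x ^ n) 1) as [B [D HBD]].
  { intros n. rewrite Cmod_mult, Cmod_pow, Rmult_1_l.
    eapply Rle_trans.
    - apply Rmult_le_compat_r; [now apply pow_le | apply rbinom_bound].
    - rewrite <- Rpow_mult_distr. apply pow_incr. split; [nra | exact Hx]. }
  assert (Hne : forall t, (0 <= t <= 1)%R -> 1 - RtoC t * x <> 0).
  { intros t Ht E. assert (E' : RtoC t * x = 1).
    { replace (RtoC t * x) with (1 - (1 - RtoC t * x)) by ring. rewrite E. ring. }
    apply (f_equal Cmod) in E'.
    rewrite Cmod_mult, Cmod_1, Cmod_real_pos in E' by lra.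
    nra. }
  assert (ODE : forall t, (0 <= t <= 1)%R ->
    D t * (1 - RtoC t * x) = q * x * B t).
  { intros t Ht. destruct (HBD t) as [HB [HD _]].
    { rewrite Rabs_pos_eq; lra. }
    apply is_Cseries_Clim in HB. apply is_Cseries_Clim in HD.
    set (tm := fun n => INR (S n) * (rbinom q (S n) * x ^ S n) * RtoC t ^ n) in *.
    (* [B' = q x B + t x B'], exactly on partial sums of lengths that differ by
       one. *)
    assert (E : forall N,
        q * x * Csum (fun n => rbinom q n * x ^ n * RtoC t ^ n) (S N)
        + RtoC t * x * Csum tm N = Csum tm (S N)).
    { assert (R : forall n, tm n = q * x * (rbinom q n * x ^ n * RtoC t ^ n)
          + x * (INR n * (rbinom q n * x ^ n * RtoC t ^ n))).
      { intros n. unfold tm.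
        replace (INR (S n) * (rbinom q (S n) * x ^ S n) * RtoC t ^ n)
          with (INR (S n) * rbinom q (S n) * (x ^ S n * RtoC t ^ n)) by ring.
        rewrite rbinom_S. simpl. ring. }
      assert (R' : forall n, RtoC t * x * tm n
          = x * (INR (S n) * (rbinom q (S n) * x ^ S n * RtoC t ^ S n))).
      { intros n. unfold tm. simpl Cpow. ring. }
      intros N. induction N as [|N IH].
      - rewrite !Csum_S, !Csum_O, R', (R 0%nat), (R 1%nat). simpl INR. ring.
      - transitivity (q * x * Csum (fun n => rbinom q n * x ^ n * RtoC t ^ n) (S N)
          + RtoC t * x * Csum tm N + tm (S (S N))).
        + rewrite (Csum_S _ (S N)), (Csum_S tm N).
          replace (RtoC t * x * (Csum tm N + tm (S N)))
            with (RtoC t * x * Csum tm N + RtoC t * x * tm (S N)) by ring.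
          rewrite R', (R (S (S N))). ring.
        + rewrite IH. symmetry. apply Csum_S. }
    assert (L : D t = q * x * B t + RtoC t * x * D t).
    { apply (Clim_unique (fun N => Csum tm (S N))).
      - apply (is_lim_seq_incr_1 (fun N => Cmod (Csum tm N - D t))). exact HD.
      - apply Clim_ext with (1 := E). apply Clim_plus; apply Clim_scal.
        + apply (is_lim_seq_incr_1 (fun N => Cmod
            (Csum (fun n => rbinom q n * x ^ n * RtoC t ^ n) N - B t))). exact HB.
        + exact HD. }
    replace (D t * (1 - RtoC t * x)) with (D t - RtoC t * x * D t) by ring.
    rewrite L at 1. ring. }
  set (E := fun t : R => Cexp (q * Clog (1 - RtoC t * x))).
  assert (HE : forall t, (0 <= t <= 1)%R ->
    is_ray_derive (fun s => B s * E s) t 0).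
  { intros t Ht. destruct (HBD t) as [_ [_ HB]].
    { rewrite Rabs_pos_eq; lra. }
    pose proof (is_ray_derive_exp _ _ _ (is_ray_derive_mult _ _ _ _ _
      (is_ray_derive_const q t) (is_ray_derive_log x t Hx2 Ht))) as H1.
    pose proof (is_ray_derive_mult _ _ _ _ _ HB H1) as H.
    replace (RtoC 0) with (D t * E t + B t *
       ((0 * Clog (1 - t * x) + q * (- x / (1 - t * x))) * E t)); [exact H|].
    replace (D t) with (q * x * B t / (1 - RtoC t * x))
      by (rewrite <- ODE by exact Ht; field; now apply Hne).
    field. now apply Hne. }
  assert (H01 : B 0%R * E 0%R = B 1%R * E 1%R).
  { assert (Q : forall z w : C, Re z = Re w -> Im z = Im w -> z = w)
      by (intros [] []; simpl; congruence).
    apply Q.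
    - apply (eq_is_derive (V := R_NormedModule) (fun s => Re (B s * E s)) 0 1);
        [intros t Ht; now apply HE | lra].
    - apply (eq_is_derive (V := R_NormedModule) (fun s => Im (B s * E s)) 0 1);
        [intros t Ht; now apply HE | lra]. }
  assert (B0 : B 0%R = 1).
  { destruct (HBD 0%R) as [HB _]; [rewrite Rabs_R0; lra|].
    apply is_Cseries_Clim in HB. apply (Clim_unique _ _ _ HB).
    apply Clim_ext with (fun _ => RtoC 1).
    - intros N. induction N as [|N IH].
      + rewrite Csum_O, rbinom_0. simpl. ring.
      + rewrite Csum_S, <- IH. simpl. ring.
    - unfold Clim. apply is_lim_seq_ext with (fun _ => 0%R).
      + intros _. replace (1 - 1) with (RtoC 0) by ring. now rewrite Cmod_0.
      + apply is_lim_seq_const. }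
  assert (E0 : E 0%R = 1).
  { unfold E. transitivity (Cexp 0); [f_equal | exact Cexp_0].
    replace (1 - 0 * x) with (RtoC 1) by ring.
    replace (Clog 1) with (RtoC 0); [ring|].
    unfold Clog. rewrite Cmod_1, ln_1. rewrite Carg_atan by (simpl; lra).
    unfold RtoC. simpl. f_equal.
    transitivity (atan 0); [symmetry; exact atan_0 | f_equal; field]. }
  destruct (HBD 1%R) as [HB _]; [rewrite Rabs_R1; lra|].
  replace (Cpower (1 - x) (- q)) with (B 1%R).
  - revert HB. apply is_Cseries_ext. intros n. rewrite Cpow_1_l. ring.
  - rewrite B0, E0 in H01.
    replace (B 1%R) with (B 1%R * (Cpower (1 - x) q * Cpower (1 - x) (- q)))
      by (rewrite Cpower_opp; ring).
    unfold E in H01. rewrite Cmult_1_l in H01. fold (Cpower (1 - 1 * x) q) in H01.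
    rewrite Cmult_1_l in H01.
    rewrite Cmult_assoc, <- H01. ring.
Qed.

(** * Composition with x / (x - 1) *)

(** The coefficients of [(1 - x)^(-q) g(x / (x - 1))], obtained from
[(1 - x)^(-q) (x / (x - 1))^k = (-1)^k x^k (1 - x)^(-q-k)]. *)
Definition reflect_coef (q : C) (g : nat -> C) (n : nat) : C :=
  Csum (fun k => g k * (-1) ^ k * rbinom (q + INR k) (n - k)) n.

(** Both sides run over the pairs [(k, j)] with [k + j <= N], grouped by
[n = k + j] on the left and by [k] on the right. *)
Lemma reflect_partial_sum q g x N :
  Csum (fun n => reflect_coef q g n * x ^ n) N =
  Csum (fun k => g k * (- x) ^ k * rbinom_sum (q + INR k) x (N - k)) N.
Proof.
  assert (P : forall k, (- x) ^ k = (-1) ^ k * x ^ k).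
  { intros k. rewrite <- Cpow_mult_l. f_equal. ring. }
  induction N as [|N IH].
  - unfold reflect_coef, rbinom_sum. rewrite !Csum_O. simpl.
    rewrite !rbinom_0. ring.
  - rewrite Csum_S, IH. unfold reflect_coef.
    rewrite (Cmult_comm _ (x ^ S N)), <- Csum_scal.
    rewrite !(Csum_S _ N), Nat.sub_diag, Cplus_assoc, <- Csum_plus.
    f_equal.
    + apply Csum_ext_le. intros k Hk.
      replace (S N - k)%nat with (S (N - k)) by lia.
      unfold rbinom_sum. rewrite Csum_S.
      replace (x ^ S N) with (x ^ k * x ^ S (N - k))
        by (rewrite <- Cpow_add_r; f_equal; lia).
      rewrite P. ring.
    + unfold rbinom_sum. rewrite Csum_O, !rbinom_0, P. simpl. ring.
Qed.

(** Regrouped by [k], the partial sums have terms that tend to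
[(1 - x)^(-q) g_k y^k] and are dominated by a geometric series of ratio
[R |x| / (1 - |x|)], so Tannery's theorem applies. *)
Lemma expands_reflect q G g :
  expands G g ->
  expands (fun x => Cpower (1 - x) (- q) * G (x / (x - 1))) (reflect_coef q g).
Proof.
  intros HG. destruct (expands_geom_bounded _ _ HG) as [M [R [HR Hg]]].
  apply expands_iff in HG. destruct HG as [r [Hr HG]].
  apply expands_iff.
  pose proof (Cmod_ge_0 q) as Hq.
  assert (HM : (0 <= M)%R).
  { specialize (Hg 0%nat). simpl in Hg. pose proof (Cmod_ge_0 (g 0%nat)). lra. }
  (* The three radii serve the binomial series, the bound [|y| <= 2 |x| < r],
     and the ratio [R |x| / (1 - |x|) < 1]. *)
  exists (Rmin (/ (2 * (1 + Cmod q))) (Rmin (r / 2) (/ (2 * R)))). split.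
  { repeat apply Rmin_pos; try apply Rinv_0_lt_compat; lra. }
  intros x Hx.
  apply Rmin_Rgt in Hx. destruct Hx as [Hx1 Hx].
  apply Rmin_Rgt in Hx. destruct Hx as [Hx2 Hx3].
  pose proof (Cmod_ge_0 x) as Hx0.
  assert (H1 : ((1 + Cmod q) * Cmod x <= / 2)%R).
  { apply Rle_trans with ((1 + Cmod q) * / (2 * (1 + Cmod q)))%R.
    - apply Rmult_le_compat_l; lra.
    - right. field. lra. }
  assert (H3 : (R * Cmod x < / 2)%R).
  { apply Rlt_le_trans with (R * / (2 * R))%R.
    - apply Rmult_lt_compat_l; lra.
    - right. field. lra. }
  assert (Hh : (Cmod x <= / 2)%R) by nra.
  assert (Hm : (1 - Cmod x <= Cmod (1 - x))%R).
  { pose proof (Cmod_triangle (1 - x) x) as T.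
    replace (1 - x + x) with (RtoC 1) in T by ring. rewrite Cmod_1 in T. lra. }
  assert (Hne : 1 - x <> 0).
  { intros E. rewrite E, Cmod_0 in Hm. lra. }
  assert (Hne' : x - 1 <> 0).
  { intros E. apply Hne. replace (1 - x) with (- (x - 1)) by ring.
    rewrite E. ring. }
  set (y := x / (x - 1)).
  assert (Ey : y = - x * / (1 - x)) by (unfold y; field; now split).
  assert (Hy : (Cmod y < r)%R).
  { rewrite Ey, Cmod_mult, Cmod_opp, Cmod_inv by exact Hne.
    apply Rle_lt_trans with (Cmod x * 2)%R; [|lra].
    apply Rmult_le_compat_l; [exact Hx0|].
    rewrite <- (Rinv_inv 2). apply Rinv_le_contravar; lra. }
  assert (HB : forall m, (rbinom_abs_sum q x m <= 2)%R).
  { intros m. unfold rbinom_abs_sum.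
    apply Rle_trans with (sum_n (fun j => (/ 2) ^ j)%R m).
    - apply Rsum_le. intros k _. rewrite Cmod_mult, Cmod_pow.
      eapply Rle_trans.
      + apply Rmult_le_compat_r; [now apply pow_le | apply rbinom_bound].
      + rewrite <- Rpow_mult_distr. apply pow_incr. split; [nra | exact H1].
    - apply Rle_trans with (2 - (/ 2) ^ m)%R.
      + right. induction m as [|m IH]; [rewrite sum_O; simpl; lra|].
        rewrite Rsum_S, IH. simpl. lra.
      + assert (0 < (/ 2) ^ m)%R by (apply pow_lt; lra). lra. }
  apply is_Cseries_Clim.
  apply Clim_ext with (1 := fun N => eq_sym (reflect_partial_sum q g x N)).
  set (P := Cpower (1 - x) (- q)).
  apply (Tannery (fun N k => g k * (- x) ^ k * rbinom_sum (q + INR k) x (N - k))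
           (fun k => P * (g k * y ^ k))
           (fun k => M * 2 * (R * Cmod x / (1 - Cmod x)) ^ k)%R).
  - intros N k. rewrite !Cmod_mult, Cmod_pow, Cmod_opp.
    apply Rle_trans with
      (M * R ^ k * Cmod x ^ k * (2 * (/ (1 - Cmod x)) ^ k))%R.
    + apply Rmult_le_compat; try apply Cmod_ge_0.
      * apply Rmult_le_pos; [apply Cmod_ge_0 | now apply pow_le].
      * apply Rmult_le_compat_r; [now apply pow_le | apply Hg].
      * eapply Rle_trans; [apply rbinom_sum_le_abs_sum|].
        apply rbinom_abs_sum_shift_bound; [lra | exact HB].
    + right. unfold Rdiv. rewrite !Rpow_mult_distr. ring.
  - apply (ex_series_scal (M * 2)%R
      (fun k => (R * Cmod x / (1 - Cmod x)) ^ k)%R).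
    apply ex_series_geom. rewrite Rabs_pos_eq.
    + apply (Rmult_lt_reg_r (1 - Cmod x)); [lra|].
      unfold Rdiv. rewrite Rmult_assoc, Rinv_l; lra.
    + apply Rmult_le_pos; [nra|]. left. apply Rinv_0_lt_compat. lra.
  - intros k.
    assert (L : Clim (rbinom_sum (q + INR k) x) (P * (/ (1 - x)) ^ k)).
    { apply rbinom_sum_shift_lim with 2%R; [lra | exact HB |].
      apply is_Cseries_Clim. now apply binomial_series. }
    apply (Clim_scal (g k * (- x) ^ k)) in L.
    replace (P * (g k * y ^ k))
      with (g k * (- x) ^ k * (P * (/ (1 - x)) ^ k))
      by (rewrite Ey, Cpow_mult_l; ring).
    apply (is_lim_seq_incr_n (fun N => Cmod (g k * (- x) ^ k *
       rbinom_sum (q + INR k) x (N - k) 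
       - g k * (- x) ^ k * (P * (/ (1 - x)) ^ k))) k).
    revert L. apply is_lim_seq_ext. intros n.
    now rewrite Nat.add_sub.
  - apply is_Cseries_Clim.
    specialize (HG y Hy). apply is_Cseries_Clim in HG.
    apply (Clim_scal P) in HG. revert HG. apply Clim_ext.
    intros n. symmetry. apply Csum_scal.
Qed.

(** * The hypergeometrization on coefficients *)

Lemma finite_lower_bound (s : nat -> C) N :
  (forall n, s n <> 0) ->
  exists m : R, (0 < m)%R /\ forall n, (n < N)%nat -> (m <= Cmod (s n))%R.
Proof.
  intros Hs. induction N as [|N [m [Hm H]]].
  - exists 1%R. split; [lra|]. intros n Hn. lia.
  - exists (Rmin m (Cmod (s N))). split.
    + apply Rmin_pos; [exact Hm|]. now apply Cmod_gt_0.
    + intros n Hn. destruct (Nat.eq_dec n N) as [->|Hne]; [apply Rmin_r|].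
      eapply Rle_trans; [apply Rmin_l | apply H; lia].
Qed.

Lemma c_shift_neq_0 (c : C) (hc : forall n : nat, c <> - INR n) n :
  c + INR n <> 0.
Proof.
  intros E. apply (hc n). replace c with (c + INR n - INR n) by ring.
  rewrite E. ring.
Qed.

Lemma poch_c_neq_0 (c : C) (hc : forall n : nat, c <> - INR n) n : poch c n <> 0.
Proof.
  induction n as [|n IH]; simpl; [apply C1_nz|].
  apply Cmult_neq_0; [exact IH | now apply c_shift_neq_0].
Qed.

(** Only finitely many [n] have [INR n <= Cmod c + 1]; beyond them the modulus
exceeds [1]. *)
Lemma c_shift_lower_bound (c : C) (hc : forall n : nat, c <> - INR n) :
  exists m : R, (0 < m)%R /\ forall n, (m <= Cmod (c + INR n))%R.
Proof.
  destruct (nfloor_ex (Cmod c + 1)) as [N0 [_ HN]].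
  { pose proof (Cmod_ge_0 c). lra. }
  destruct (finite_lower_bound (fun n => c + INR n) (S N0) (c_shift_neq_0 c hc))
    as [m [Hm H]].
  exists (Rmin m 1). split; [apply Rmin_pos; lra|].
  intros n. destruct (Nat.lt_ge_cases n (S N0)) as [Hn|Hn].
  - eapply Rle_trans; [apply Rmin_l | now apply H].
  - eapply Rle_trans; [apply Rmin_r|].
    apply le_INR in Hn. rewrite S_INR in Hn.
    pose proof (Cmod_triangle (c + INR n) (- c)) as T.
    replace (c + INR n + - c) with (RtoC (INR n)) in T by ring.
    rewrite Cmod_opp, Cmod_real_pos in T by apply pos_INR. lra.
Qed.

(** Consecutive ratios [(a + n) / (c + n) = 1 + (a - c) / (c + n)] are bounded. *)
Lemma poch_ratio_bound (a c : C) (hc : forall n : nat, c <> - INR n) :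
  exists K : R, (0 < K)%R /\ forall n, (Cmod (poch a n / poch c n) <= K ^ n)%R.
Proof.
  destruct (c_shift_lower_bound c hc) as [m [Hm H]].
  exists (1 + Cmod (a - c) * / m)%R.
  assert (P : (0 <= Cmod (a - c) * / m)%R).
  { apply Rmult_le_pos; [apply Cmod_ge_0|]. left. now apply Rinv_0_lt_compat. }
  split; [lra|]. intros n. induction n as [|n IH].
  - simpl. replace (1 / 1) with (RtoC 1) by field. rewrite Cmod_1. lra.
  - pose proof (c_shift_neq_0 c hc n) as Hn.
    replace (poch a (S n) / poch c (S n))
      with ((1 + (a - c) * / (c + INR n)) * (poch a n / poch c n))
      by (simpl; field; split; [exact Hn | now apply poch_c_neq_0]).
    rewrite Cmod_mult. simpl pow.
    apply Rmult_le_compat; try apply Cmod_ge_0; [|exact IH].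
    eapply Rle_trans; [apply Cmod_triangle|].
    rewrite Cmod_1, Cmod_mult, Cmod_inv by exact Hn.
    apply Rplus_le_compat_l, Rmult_le_compat_l; [apply Cmod_ge_0|].
    apply Rinv_le_contravar; [exact Hm | apply H].
Qed.

Definition hyp_coef (a c : C) (g : nat -> C) (n : nat) : C :=
  g n * (poch a n / poch c n).

Lemma hyp_coef_geom_bounded (a c : C) (hc : forall n : nat, c <> - INR n) g :
  geom_bounded g -> geom_bounded (hyp_coef a c g).
Proof.
  intros [M [R [HR Hg]]]. destruct (poch_ratio_bound a c hc) as [K [HK H]].
  exists M, (R * K)%R. split; [now apply Rmult_lt_0_compat|].
  intros n. unfold hyp_coef. rewrite Cmod_mult, Rpow_mult_distr, <- Rmult_assoc.
  apply Rmult_le_compat; try apply Cmod_ge_0; [apply Hg | apply H].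
Qed.

Lemma expands_hypergeom (a c : C) (hc : forall n : nat, c <> - INR n) f u :
  expands f u -> expands (hypergeom a c f) (hyp_coef a c u).
Proof.
  intros H.
  pose proof (expands_CSeries _
    (hyp_coef_geom_bounded a c hc _ (expands_geom_bounded _ _ H))) as E.
  revert E. apply expands_germ. apply locally0_iff.
  exists 1%R. split; [lra|]. intros x _. apply CSeries_ext.
  intros n. now rewrite (coefs_expands _ _ H).
Qed.

(** The heart of the identity: multiplying by [(a)_n / (c)_n] turns the exponent
[-c-k] of the [k]-th binomial series into [-a-k], because
[(q)_n = (q)_k (q + k)_(n-k)] both for [q = a] and for [q = c]. *)
Lemma hyp_coef_reflect (a c : C) (hc : forall n : nat, c <> - INR n) g n :
  hyp_coef a c (reflect_coef c g) n = reflect_coef a (hyp_coef a c g) n.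
Proof.
  unfold hyp_coef, reflect_coef.
  rewrite (Cmult_comm (Csum _ _)), <- Csum_scal.
  apply Csum_ext_le. intros k Hk.
  replace (poch a n) with (poch a (k + (n - k))) by (f_equal; lia).
  replace (poch c n) with (poch c (k + (n - k))) by (f_equal; lia).
  pose proof (poch_c_neq_0 c hc (k + (n - k))) as N.
  rewrite poch_add in N |- *. rewrite (poch_add c).
  assert (N1 : poch c k <> 0) by now apply poch_c_neq_0.
  assert (N2 : poch (c + INR k) (n - k) <> 0).
  { intros E. apply N. rewrite E. ring. }
  unfold rbinom. field. repeat split; try assumption. apply INR_fact_neq_0_C.
Qed.

(** The case [q = 0], where the power is [1]. *)
Lemma expands_compose_y G g :
  expands G g -> expands (fun x => G (x / (x - 1))) (reflect_coef 0 g).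
Proof.
  intros H. pose proof (expands_reflect 0 G g H) as E. revert E.
  apply expands_germ, locally0_iff. exists 1%R. split; [lra|]. intros x _.
  replace (- 0) with (RtoC 0) by ring. rewrite Cpower_0. ring.
Qed.

Lemma y_involutive (x : C) : x <> 1 -> x / (x - 1) / (x / (x - 1) - 1) = x.
Proof.
  intros H. assert (x - 1 <> 0).
  { intros E. apply H. replace x with (x - 1 + 1) by ring. rewrite E. ring. }
  field. split; [assumption|].
  replace (x - (x - 1)) with (RtoC 1) by ring. exact C1_nz.
Qed.

(** Since [y] is an involution, [f o y] is an admissible factor. *)
Lemma factor_through_y f :
  analytic0 f ->
  analytic0 (factor_through (fun x => x / (x - 1)) f) /\
  germ_eq f (fun x => factor_through (fun x => x / (x - 1)) f (x / (x - 1))).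
Proof.
  intros [u Hu]. unfold factor_through.
  apply (epsilon_spec (inhabits (fun _ : C => RtoC 0))
    (fun g => analytic0 g /\ germ_eq f (fun x => g (x / (x - 1))))).
  exists (fun x => f (x / (x - 1))). split.
  - exists (reflect_coef 0 u). now apply expands_compose_y.
  - apply locally0_iff. exists 1%R. split; [lra|]. intros x Hx.
    rewrite y_involutive; [reflexivity|].
    intros ->. rewrite Cmod_1 in Hx. lra.
Qed.

Theorem proposition7 (a c : C) (hc : forall n : nat, c <> - INR n) :
  op_eq
    (op_comp (mult_op (fun x => Cpower (1 - x) a))
       (op_comp (hypergeom a c)
          (mult_op (fun x => Cpower (1 - x) (- c)))))
    (hypergeom_along a c (fun x => x / (x - 1))).
Proof.
  intros f Hf. destruct (factor_through_y f Hf) as [[g Hg] HfG].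
  unfold op_comp, mult_op, hypergeom_along.
  set (G := factor_through (fun x => x / (x - 1)) f) in *.
  pose proof (expands_hypergeom a c hc G g Hg) as HH.
  assert (HF : expands (fun x => Cpower (1 - x) (- c) * f x) (reflect_coef c g)).
  { apply expands_germ with (2 := expands_reflect c G g Hg).
    revert HfG. unfold germ_eq. apply filter_imp. intros x Hx. now rewrite Hx. }
  apply (expands_hypergeom a c hc) in HF.
  apply (expands_ext _ _ _ (hyp_coef_reflect a c hc g)) in HF.
  pose proof (expands_germ_eq _ _ _ HF (expands_reflect a _ _ HH)) as HE.
  pose proof (expands_compose_y _ _ HH) as HB.
  assert (HAB : germ_eq
    (fun x => Cpower (1 - x) a *
       hypergeom a c (fun x => Cpower (1 - x) (- c) * f x) x)
    (fun x => hypergeom a c G (x / (x - 1)))).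
  { revert HE. unfold germ_eq. apply filter_imp. intros x Hx. rewrite Hx.
    rewrite Cmult_assoc, Cpower_opp. apply Cmult_1_l. }
  split; [|split].
  - exists (reflect_coef 0 (hyp_coef a c g)).
    now apply expands_germ with (1 := HAB).
  - exists (reflect_coef 0 (hyp_coef a c g)). exact HB.
  - exact HAB.
Qed.
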